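(* The paraquaternionic Heisenberg group $G(pH)$ and the para 3-Sasakian pseudo-sphere $pS^{4n+3}$ are locally pqc conformally equivalent via the paraquaternionic Cayley transform $\mathbb C:\ pS^{4n+3}\setminus\Sigma_0\to\Sigma\cong G(pH)$; that is, $\mathbb C$ is a local diffeomorphism and $\mathbb C^*\tilde\Theta=\nu\,\Psi\,\tilde\eta$ for a nowhere vanishing smooth function $\nu$ and a smooth $SO(1,2)$-valued function $\Psi$.
   Context: $pH$ is the real algebra of para quaternions with basis $1,r_1,r_2,r_3$, $r_1^2=r_2^2=1$, $r_3^2=-1$, $r_1r_2=-r_2r_1=r_3$; for $p=t+r_3x+r_1y+r_2z$, $\mathrm{Re}\,p=t$, $\bar p=t-r_3x-r_1y-r_2z$ and $|p|^2=p\bar p=t^2+x^2-y^2-z^2$; on $pH^n$, $|q|^2=\sum_a|q^a|^2$ and $q\bar q'=\sum_aq^a\overline{q'^a}$. $SO(1,2)$ is the special orthogonal group of the quadratic form of signature $(1,2)$ on $\mathrm{Im}\,pH\cong\mathbb R^3$. Heisenberg group: $G(pH)=pH^n\times\mathrm{Im}\,pH$ with $(q_o,\omega_o)\circ(q,\omega)=(q_o+q,\omega_o+\omega+2\,\mathrm{Im}(q_o\bar q))$ and standard pqc (paraquaternionic contact) form $\tilde\Theta=\frac12(d\omega-q\cdot d\bar q+dq\cdot\bar q)$, an $\mathrm{Im}\,pH$-valued 1-form. It is identified with the hypersurface $\Sigma=\{(q',p')\in pH^n\times pH:\ \mathrm{Re}(p')=-|q'|^2\}$ by $(q',\omega')\mapsto(q',\,p'=-|q'|^2+\omega')$.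 Pseudo-sphere: $pS^{4n+3}=\{(q,p)\in pH^n\times pH:\ |q|^2+|p|^2=1\}$ with standard pqc (para 3-Sasakian) form $\tilde\eta=dq\cdot\bar q+dp\cdot\bar p-q\cdot d\bar q-p\cdot d\bar p$. $\Sigma_0=\{(q,p)\in pS^{4n+3}:\ |p-1|^2=0\}$. Cayley transform: $\mathbb C(q,p)=(q',p')$ with $q'=(p-1)^{-1}q$, $p'=(p-1)^{-1}(p+1)$ for $(q,p)\in pS^{4n+3}\setminus\Sigma_0$. Two pqc structures with contact forms $\eta,\bar\eta$ ($\mathbb R^3$-valued) are pqc conformal if $\bar\eta=\nu\Psi\eta$ with $\nu$ nowhere vanishing smooth and $\Psi$ smooth $SO(1,2)$-valued. *)

(* Defs.v *)
From HB Require Import structures.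
From mathcomp Require Import all_boot all_order all_algebra.
From mathcomp Require Import all_classical all_reals all_analysis.
From mathcomp Require Import ring.

Set Implicit Arguments.
Unset Strict Implicit.
Unset Printing Implicit Defensive.

Import Order.TTheory GRing.Theory Num.Theory.
Import numFieldNormedType.Exports.

Local Open Scope classical_set_scope.
Local Open Scope ring_scope.

(* The coordinates of p : pquat R are taken in the basis 1, r1, r2, r3.  Hence
   p = t + r3 x + r1 y + r2 z has p 0 0 = t, p 1 0 = y, p 2 0 = z, p 3 0 = x. *)
Definition pquat (R : realType) := 'cV[R]_4.

Section Paraquaternions.
Variable R : realType.

HB.instance Definition _ := NormedModule.copy (pquat R) 'cV[R]_4.

Implicit Types p q : pquat R.

Definition pq4 (a b c d : R) : pquat R := \col_i [:: a; b; c; d]`_i.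

Lemma pq4E0 a b c d : pq4 a b c d 0 0 = a. Proof. by rewrite mxE. Qed.
Lemma pq4E1 a b c d : pq4 a b c d 1 0 = b. Proof. by rewrite mxE. Qed.
Lemma pq4E2 a b c d : pq4 a b c d 2 0 = c. Proof. by rewrite mxE. Qed.
Lemma pq4E3 a b c d : pq4 a b c d 3 0 = d. Proof. by rewrite mxE. Qed.
Definition pq4E := (pq4E0, pq4E1, pq4E2, pq4E3).

Lemma pq_ext p q :
  p 0 0 = q 0 0 -> p 1 0 = q 1 0 -> p 2 0 = q 2 0 -> p 3 0 = q 3 0 -> p = q.
Proof.
move=> e0 e1 e2 e3; apply/colP => -[[|[|[|[|//]]]] lt_i].
- by rewrite (_ : Ordinal lt_i = 0) //; apply: val_inj.
- by rewrite (_ : Ordinal lt_i = 1) //; apply: val_inj.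
- by rewrite (_ : Ordinal lt_i = 2) //; apply: val_inj.
- by rewrite (_ : Ordinal lt_i = 3) //; apply: val_inj.
Qed.

Definition pq_one : pquat R := pq4 1 0 0 0.

Definition pq_mul p q : pquat R :=
  pq4 (p 0 0 * q 0 0 + p 1 0 * q 1 0 + p 2 0 * q 2 0 - p 3 0 * q 3 0)
      (p 0 0 * q 1 0 + p 1 0 * q 0 0 - p 2 0 * q 3 0 + p 3 0 * q 2 0)
      (p 0 0 * q 2 0 + p 2 0 * q 0 0 + p 1 0 * q 3 0 - p 3 0 * q 1 0)
      (p 0 0 * q 3 0 + p 3 0 * q 0 0 + p 1 0 * q 2 0 - p 2 0 * q 1 0).

Fact pq_mulA : associative pq_mul.
Proof. by move=> p q r; apply: pq_ext; rewrite !pq4E; ring. Qed.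

Fact pq_mul1 : left_id pq_one pq_mul.
Proof. by move=> p; apply: pq_ext; rewrite !pq4E; ring. Qed.

Fact pq_mulr1 : right_id pq_one pq_mul.
Proof. by move=> p; apply: pq_ext; rewrite !pq4E; ring. Qed.

Fact pq_mulDl : left_distributive pq_mul +%R.
Proof. by move=> p q r; apply: pq_ext; rewrite !(pq4E, mxE) /=; ring. Qed.

Fact pq_mulDr : right_distributive pq_mul +%R.
Proof. by move=> p q r; apply: pq_ext; rewrite !(pq4E, mxE) /=; ring. Qed.

Fact pq_one_neq0 : pq_one != 0.
Proof. by apply/eqP => /colP/(_ 0)/eqP; rewrite !mxE oner_eq0. Qed.

HB.instance Definition _ := GRing.Zmodule_isNzRing.Build (pquat R)
  pq_mulA pq_mul1 pq_mulr1 pq_mulDl pq_mulDr pq_one_neq0.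

Fact pq_scalerAl (a : R) p q : a *: (p * q) = (a *: p) * q.
Proof. by apply: pq_ext; rewrite !(pq4E, mxE) /=; ring. Qed.

HB.instance Definition _ := GRing.Lmodule_isLalgebra.Build R (pquat R) pq_scalerAl.

Fact pq_scalerAr (a : R) p q : a *: (p * q) = p * (a *: q).
Proof. by apply: pq_ext; rewrite !(pq4E, mxE) /=; ring. Qed.

HB.instance Definition _ := GRing.Lalgebra_isAlgebra.Build R (pquat R) pq_scalerAr.

Definition r1 : pquat R := pq4 0 1 0 0.
Definition r2 : pquat R := pq4 0 0 1 0.
Definition r3 : pquat R := pq4 0 0 0 1.

Lemma pquat_relations :
  [/\ r1 * r1 = 1, r2 * r2 = 1, r3 * r3 = -1, r1 * r2 = r3 & r2 * r1 = - r3].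
Proof. by split; apply: pq_ext; rewrite !(pq4E, mxE) /=; ring. Qed.

Lemma pquat_basis p :
  p = (p 0 0)%:A + p 3 0 *: r3 + p 1 0 *: r1 + p 2 0 *: r2.
Proof. by apply: pq_ext; rewrite !(pq4E, mxE) /=; ring. Qed.

Definition pqRe p : R := p 0 0.

(* Im pH is identified with R^3 through the basis r1, r2, r3. *)
Definition pqIm p : 'cV[R]_3 := \col_i p (lift 0 i) 0.
Definition pure (w : 'cV[R]_3) : pquat R := col_mx (0 : 'cV[R]_1) w.

Lemma pureK : cancel pure pqIm.
Proof.
move=> w; apply/colP => i; rewrite mxE.
have -> : lift 0 i = rshift 1 i by apply: val_inj.
exact: (@col_mxEd _ 1 3 1).
Qed.

Lemma pqRe_pure w : pqRe (pure w) = 0.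
Proof.
rewrite /pqRe /pure; have -> : (0 : 'I_4) = lshift 3 (0 : 'I_1) by apply: val_inj.
by rewrite (@col_mxEu _ 1 3 1) mxE.
Qed.

Lemma pq_ReIm p q : pqRe p = pqRe q -> pqIm p = pqIm q -> p = q.
Proof.
move=> eqRe /colP eqIm; apply/colP => i.
by case: (unliftP 0 i) => [j|] ->; [have := eqIm j; rewrite !mxE | exact: eqRe].
Qed.

Lemma pqImK p : pqRe p = 0 -> pure (pqIm p) = p.
Proof. by move=> Rep0; apply: pq_ReIm; rewrite ?pqRe_pure ?pureK. Qed.

Definition pqconj p : pquat R := pq4 (p 0 0) (- p 1 0) (- p 2 0) (- p 3 0).

(* |p|^2 = t^2 + x^2 - y^2 - z^2 *)
Definition pqnorm2 p : R :=
  p 0 0 ^+ 2 + p 3 0 ^+ 2 - p 1 0 ^+ 2 - p 2 0 ^+ 2.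

Lemma mul_pqconj p : p * pqconj p = (pqnorm2 p)%:A.
Proof. by apply: pq_ext; rewrite !(pq4E, mxE) /pqnorm2 /=; ring. Qed.

Lemma pqconj_mul p : pqconj p * p = (pqnorm2 p)%:A.
Proof. by apply: pq_ext; rewrite !(pq4E, mxE) /pqnorm2 /=; ring. Qed.

Lemma pqnorm2M p q : pqnorm2 (p * q) = pqnorm2 p * pqnorm2 q.
Proof. by rewrite /pqnorm2 !pq4E; ring. Qed.

Definition pq_unit : pred (pquat R) := fun p => pqnorm2 p != 0.
Definition pq_inv p : pquat R :=
  if pqnorm2 p == 0 then p else (pqnorm2 p)^-1 *: pqconj p.

Fact pq_mulVp : {in pq_unit, left_inverse 1 pq_inv *%R}.
Proof.
move=> p; rewrite -topredE /= /pq_unit /pq_inv => p_neq0.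
by rewrite (negPf p_neq0) -scalerAl pqconj_mul scalerA mulVf // scale1r.
Qed.

Fact pq_mulpV : {in pq_unit, right_inverse 1 pq_inv *%R}.
Proof.
move=> p; rewrite -topredE /= /pq_unit /pq_inv => p_neq0.
by rewrite (negPf p_neq0) -scalerAr mul_pqconj scalerA mulVf // scale1r.
Qed.

Fact pq_unitP p q : q * p = 1 /\ p * q = 1 -> pq_unit p.
Proof.
case=> /(congr1 pqnorm2) + _; rewrite pqnorm2M.
have -> : pqnorm2 1 = 1 by rewrite /pqnorm2 !pq4E; ring.
by rewrite /pq_unit => qp1; apply/eqP => p0; move/eqP: qp1; rewrite p0 mulr0 eq_sym oner_eq0.
Qed.

Fact pq_inv_out : {in [predC pq_unit], pq_inv =1 id}.
Proof. by move=> p; rewrite -topredE /= /pq_unit /pq_inv negbK => ->. Qed.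

HB.instance Definition _ := GRing.NzRing_hasMulInverse.Build (pquat R)
  pq_mulVp pq_mulpV pq_unitP pq_inv_out.

Definition SO12 : set 'M[R]_3 :=
  [set A | \det A = 1 /\
           forall w : 'cV[R]_3, pqnorm2 (pure (A *m w)) = pqnorm2 (pure w)].

Variable n : nat.

(* pH^n; the a-th column of q is the paraquaternion q^a. *)
Definition hvec := 'M[R]_(4, n).

Definition hcoord (q : hvec) (a : 'I_n) : pquat R := col a q.

Definition hmul (u : pquat R) (q : hvec) : hvec :=
  \matrix_(i, a) (u * hcoord q a) i 0.

Definition hnorm2 (q : hvec) : R := \sum_a pqnorm2 (hcoord q a).

Definition hdot (q q' : hvec) : pquat R :=
  \sum_a hcoord q a * pqconj (hcoord q' a).

End Paraquaternions.

Definition heis (R : realType) (n : nat) := (hvec R n * 'cV[R]_3)%type.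

Section Heisenberg.
Variables (R : realType) (n : nat).

HB.instance Definition _ := NormedModule.copy (heis R n) (hvec R n * 'cV[R]_3)%type.

Implicit Types g h : heis R n.

Definition heis_mul g h : heis R n :=
  (g.1 + h.1, g.2 + h.2 + 2 *: pqIm (hdot g.1 h.1)).
Definition heis_one : heis R n := (0, 0).
Definition heis_inv g : heis R n := (- g.1, - g.2).

Lemma pqIm_is_linear : linear (@pqIm R).
Proof. by move=> a p q; apply/colP => i; rewrite !mxE. Qed.
HB.instance Definition _ :=
  GRing.isLinear.Build R (pquat R) 'cV[R]_3 _ (@pqIm R) pqIm_is_linear.

Lemma pqconj_is_linear : linear (@pqconj R).
Proof. by move=> a p q; apply: pq_ext; rewrite !(pq4E, mxE) /=; ring. Qed.
HB.instance Definition _ :=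
  GRing.isLinear.Build R (pquat R) (pquat R) _ (@pqconj R) pqconj_is_linear.

Lemma hcoordD (q q' : hvec R n) a : hcoord (q + q') a = hcoord q a + hcoord q' a.
Proof. by apply/colP => i; rewrite !mxE. Qed.

Lemma hcoordN (q : hvec R n) a : hcoord (- q) a = - hcoord q a.
Proof. by apply/colP => i; rewrite !mxE. Qed.

Lemma hcoord0 a : hcoord (0 : hvec R n) a = 0.
Proof. by apply/colP => i; rewrite !mxE. Qed.

Lemma hdotDl (q q' r : hvec R n) : hdot (q + q') r = hdot q r + hdot q' r.
Proof.
by rewrite /hdot -big_split; apply: eq_bigr => a _; rewrite hcoordD mulrDl.
Qed.

Lemma hdotDr (q r r' : hvec R n) : hdot q (r + r') = hdot q r + hdot q r'.
Proof.
rewrite /hdot -big_split; apply: eq_bigr => a _.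
by rewrite hcoordD raddfD mulrDr.
Qed.

Lemma hdotNl (q r : hvec R n) : hdot (- q) r = - hdot q r.
Proof.
by rewrite /hdot -sumrN; apply: eq_bigr => a _; rewrite hcoordN mulNr.
Qed.

Lemma hdot0l (q : hvec R n) : hdot 0 q = 0.
Proof. by rewrite /hdot big1 // => a _; rewrite hcoord0 mul0r. Qed.

Lemma hdot0r (q : hvec R n) : hdot q 0 = 0.
Proof. by rewrite /hdot big1 // => a _; rewrite hcoord0 raddf0 mulr0. Qed.

Lemma hdotxx (q : hvec R n) : hdot q q = (hnorm2 q)%:A.
Proof.
by rewrite /hnorm2 scaler_suml; apply: eq_bigr => a _; rewrite mul_pqconj.
Qed.

Lemma pqIm_scalar (a : R) : pqIm a%:A = 0.
Proof.
rewrite linearZ /= (_ : pqIm 1 = 0) ?scaler0 //.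
by apply/colP => -[[|[|[|//]]] ?]; rewrite !mxE.
Qed.

Lemma hdotC (q r : hvec R n) : hdot r q = pqconj (hdot q r).
Proof.
rewrite raddf_sum; apply: eq_bigr => a _.
by apply: pq_ext; rewrite !pq4E; ring.
Qed.

Fact heis_mulA : associative heis_mul.
Proof.
move=> g h k; rewrite /heis_mul /=; congr pair; first by rewrite addrA.
by rewrite hdotDl hdotDr; apply/colP => i; rewrite !mxE; ring.
Qed.

Fact heis_mul1 : left_id heis_one heis_mul.
Proof.
by case=> q w; rewrite /heis_mul /= hdot0l linear0 scaler0 !add0r addr0.
Qed.

Fact heis_mulr1 : right_id heis_one heis_mul.
Proof.
by case=> q w; rewrite /heis_mul /= hdot0r linear0 scaler0 !addr0.
Qed.

Fact heis_mulV : left_inverse heis_one heis_inv heis_mul.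
Proof.
move=> g; rewrite /heis_mul /= !addNr hdotNl hdotxx linearN /= pqIm_scalar.
by rewrite oppr0 scaler0 addr0.
Qed.

Fact heis_mulrV : right_inverse heis_one heis_inv heis_mul.
Proof.
move=> g; have {1}-> : g = heis_inv (heis_inv g).
  by case: g => q w; rewrite /heis_inv /= !opprK.
exact: heis_mulV.
Qed.

HB.instance Definition _ := isGroup.Build (heis R n)
  heis_mulA heis_mul1 heis_mulr1 heis_mulV heis_mulrV.

Lemma heisM g h :
  (g * h)%g = (g.1 + h.1, g.2 + h.2 + 2 *: pqIm (hdot g.1 h.1)) :> heis R n.
Proof. by []. Qed.

End Heisenberg.

(* A k-times continuously differentiable map on an open set U; the recursion
   goes through all directional derivatives, so this is the usual notion when
   V is finite dimensional. *)
Fixpoint Ck_on (R : realType) (V W : normedModType R) (k : nat)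
    (U : set V) (f : V -> W) : Prop :=
  match k with
  | 0 => forall x, U x -> {for x, continuous f}
  | k'.+1 => (forall x, U x -> differentiable f x) /\
             (forall v : V, Ck_on k' U (fun x => 'D_v f x))
  end.

Section SmoothMaps.
Variable R : realType.
Implicit Types V W : normedModType R.

Definition smooth_on_open V W (U : set V) (f : V -> W) : Prop :=
  forall k, Ck_on k U f.

(* Smoothness on an arbitrary subset S (in particular on an embedded
   submanifold): near each point of S, f|S extends to a smooth map on an open
   set of the ambient space. *)
Definition smooth_on V W (S : set V) (f : V -> W) : Prop :=
  forall x, S x -> exists (U : set V) (g : V -> W),
    [/\ open U, U x, smooth_on_open U g & forall y, (S `&` U) y -> g y = f y].

(* v is the velocity at x of a smooth curve contained in S. *)
Definition tangent V (S : set V) (x v : V) : Prop :=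
  exists (e : R) (c : R -> V),
    [/\ 0 < e, smooth_on_open (ball 0 e) c, forall t, ball 0 e t -> S (c t),
        c 0 = x & 'D_1 c 0 = v].

Definition local_diffeo V W (M : set V) (N : set W) (f : V -> W) : Prop :=
  forall x, M x -> exists (U : set V) (U' : set W) (g : W -> V),
    [/\ open U /\ U x, open U', f @` (M `&` U) = N `&` U',
        {in M `&` U, cancel f g} &
        smooth_on (M `&` U) f /\ smooth_on (N `&` U') g].

(* Im pH-valued 1-forms, as functions of the base point and of the vector.
   Along a submanifold S only the values on tangent vectors of S matter; on
   these 'd f x v depends only on f|S, so that f may be given by any
   differentiable ambient extension. *)
Definition form1 V := V -> V -> 'cV[R]_3.

Definition pullback V W (f : V -> W) (theta : form1 W) : form1 V :=
  fun x v => theta (f x) ('d f x v).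

Definition pqc_conformal V (S : set V) (eta eta' : form1 V) : Prop :=
  exists (nu : V -> R) (Psi : V -> 'M[R]_3),
    [/\ smooth_on S nu, smooth_on S Psi,
        forall x, S x -> nu x != 0, forall x, S x -> SO12 (Psi x) &
        forall x v, S x -> tangent S x v ->
          eta' x v = nu x *: (Psi x *m eta x v)].

End SmoothMaps.

Section CayleyTransform.
Variables (R : realType) (n : nat).

Definition ambient := (hvec R n * pquat R)%type.

Implicit Types (x v : ambient) (g h : heis R n).

Definition heis_hypersurface : set ambient := [set x | pqRe x.2 = - hnorm2 x.1].

(* The identification of G(pH) with the hypersurface, and its inverse. *)
Definition sigma_of_heis g : ambient := (g.1, (- hnorm2 g.1)%:A + pure g.2).
Definition heis_of_sigma x : heis R n := (x.1, pqIm x.2).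

Lemma sigma_of_heisP g : heis_hypersurface (sigma_of_heis g).
Proof.
rewrite /heis_hypersurface /= /pqRe mxE [pure _ 0 0]pqRe_pure addr0.
by rewrite !mxE /= mulr1.
Qed.

Lemma sigma_of_heisK : cancel sigma_of_heis heis_of_sigma.
Proof.
by case=> q w; rewrite /heis_of_sigma /= linearD /= pqIm_scalar add0r pureK.
Qed.

Lemma heis_of_sigmaK : {in heis_hypersurface, cancel heis_of_sigma sigma_of_heis}.
Proof.
move=> x /set_mem Sx.
have /(congr1 snd) /= eqIm := sigma_of_heisK (heis_of_sigma x).
have /= eqRe := sigma_of_heisP (heis_of_sigma x).
apply: injective_projections => //=.
by apply: pq_ReIm => //; rewrite Sx.
Qed.

(* (dw - q . d(conj q) + dq . conj q) / 2 *)
Definition heis_form : form1 (heis R n) := fun g dg =>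
  pqIm (2^-1 *: (pure dg.2 - hdot g.1 dg.1 + hdot dg.1 g.1)).

Lemma heis_form_im g dg :
  pure (heis_form g dg) = 2^-1 *: (pure dg.2 - hdot g.1 dg.1 + hdot dg.1 g.1).
Proof.
have eqRe (a : R) (p q r : pquat R) :
  pqRe (a *: (p - q + r)) = a * (pqRe p - pqRe q + pqRe r) by rewrite /pqRe !mxE.
by apply: pqImK; rewrite eqRe pqRe_pure (hdotC dg.1) /pqRe !pq4E; ring.
Qed.

Definition sigma_form : form1 ambient := pullback heis_of_sigma heis_form.

Definition pseudo_sphere : set ambient :=
  [set x | hnorm2 x.1 + pqnorm2 x.2 = 1].

(* dq . conj q + dp . conj p - q . d(conj q) - p . d(conj p) *)
Definition sphere_form : form1 ambient := fun x dx =>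
  pqIm (hdot dx.1 x.1 + dx.2 * pqconj x.2 - hdot x.1 dx.1 - x.2 * pqconj dx.2).

Lemma sphere_form_im x dx : pure (sphere_form x dx) =
  hdot dx.1 x.1 + dx.2 * pqconj x.2 - hdot x.1 dx.1 - x.2 * pqconj dx.2.
Proof.
have eqRe (p q r s : pquat R) :
  pqRe (p + q - r - s) = pqRe p + pqRe q - pqRe r - pqRe s by rewrite /pqRe !mxE.
by apply: pqImK; rewrite eqRe (hdotC dx.1) /pqRe !pq4E; ring.
Qed.

Definition sigma0 : set ambient :=
  [set x | pseudo_sphere x /\ pqnorm2 (x.2 - 1) = 0].

(* Total on the ambient space; the inverse is genuine where |p - 1|^2 <> 0. *)
Definition cayley x : ambient :=
  (hmul (x.2 - 1)^-1 x.1, (x.2 - 1)^-1 * (x.2 + 1)).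

End CayleyTransform.

Arguments ambient : clear implicits.
Arguments heis_hypersurface : clear implicits.
Arguments heis_form : clear implicits.
Arguments sigma_form : clear implicits.
Arguments pseudo_sphere : clear implicits.
Arguments sphere_form : clear implicits.
Arguments sigma0 : clear implicits.
Arguments cayley : clear implicits.

(* Main.v *)
(* Put u = (p - 1)^-1.  The Cayley transform reads q' = u q, p' = 1 + 2 u, so
   p' - 1 = 2 u is invertible, and q = 2 (p' - 1)^-1 q', p = 1 + 2 (p' - 1)^-1
   is a rational inverse, defined where |p' - 1|^2 <> 0.  The identity
   Re p' + |q'|^2 = |u|^2 (|q|^2 + |p|^2 - 1) shows that the pseudo-sphere
   corresponds to the hypersurface.  Since du = - u dp u, one has
   dq' = u dq - u dp u q and dp' = - 2 u dp u, and on the pseudo-sphere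
   2 C^* Theta = u eta (conj u).  As u = |p - 1|^-2 conj (p - 1), this is the
   asserted form with nu = 1 / (2 |p - 1|^2) and Psi the conjugation
   w |-> (p - 1)^-1 w (p - 1), which lies in SO(1,2) whatever the sign of
   |p - 1|^2. *)
From HB Require Import structures.
Require Import Defs.
From mathcomp Require Import all_boot all_order all_algebra.
From mathcomp Require Import all_classical all_reals all_analysis.
From mathcomp Require Import ring.

Set Implicit Arguments.
Unset Strict Implicit.
Unset Printing Implicit Defensive.

Import Order.TTheory GRing.Theory Num.Theory.
Import numFieldNormedType.Exports.

Local Open Scope classical_set_scope.
Local Open Scope ring_scope.

(** * Calculus of maps of class C^k on an open set *)

Lemma near_eq_differentiable (R : realType) (V W : normedModType R)
    (f g : V -> W) (x : V) :
  (\near x, f x = g x) -> differentiable f x -> differentiable g x.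
Proof.
move=> fg df; have fgx := nbhs_singleton fg.
(* The differential of f also gives a first-order expansion of g at x; uniqueness then identifies it
   with the differential of g. *)
have eqg : g \o shift x = cst (g x) + 'd f x +o_ 0 id.
  apply/eqaddoP => e e0.
  have /eqaddoP/(_ e e0) := diff_locally df.
  move: fg; rewrite (near_shift 0) subr0 => fg.
  by apply: filterS2 fg => h /= fgh; rewrite !fctE /= -fgx fgh.
have cdf := diff_continuous df.
by apply/diff_locallyP; rewrite (diff_unique cdf eqg).
Qed.

(** Kept as a predicate on plain functions, so that the various products need no bundled structure
    of their own; [derive_bilin] builds the bundle when it differentiates. *)
Definition bilinear_map (R : realType) (U V W : lmodType R) (B : U -> V -> W) :=
  (forall v, linear (B^~ v)) /\ (forall u, linear (B u)).

Section CkCalculus.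
Variable R : realType.
Implicit Types U V W : normedModType R.

(** As A is open, equality on A is equality near each of its points, hence passes to derivatives.
    Later inductions on k can thus replace a derivative by a formula valid on A only. *)
Lemma Ck_on_ext V W k (A : set V) (f g : V -> W) :
  open A -> (forall x, A x -> f x = g x) -> Ck_on k A f -> Ck_on k A g.
Proof.
move=> oA; elim: k f g => [|k IHk] f g eq_fg /=;
    have near_fg x : A x -> \forall y \near x, f y = g y
      by move=> Ax; exact: filterS (open_nbhs_nbhs (conj oA Ax)).
  move=> Cf x Ax; rewrite /prop_for /continuous_at -(eq_fg _ Ax).
  by apply: cvg_trans (Cf x Ax); apply: near_eq_cvg; exact: near_fg.
case=> df Cdf; split=> [x Ax|v].
  by apply: near_eq_differentiable (df x Ax); exact: near_fg.
by apply: IHk (Cdf v) => x Ax; exact/near_eq_derive/near_fg.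
Qed.

Lemma Ck_onW V W k (A : set V) (f : V -> W) : Ck_on k.+1 A f -> Ck_on k A f.
Proof.
elim: k f => [|k IHk] f [df Cdf] /=; last by split=> // v; apply: IHk.
by move=> x Ax; exact/differentiable_continuous/df.
Qed.

Lemma Ck_on_cst V W k (A : set V) (c : W) : Ck_on k A (cst c : V -> W).
Proof.
elim: k c => [|k IHk] c /=; first by move=> x _; exact: cst_continuous.
split=> [x _|v]; first exact: differentiable_cst.
by rewrite (_ : (fun x => _) = cst 0) //; apply/funext => x; rewrite derive_cst.
Qed.

Lemma Ck_on_id V k (A : set V) : Ck_on k A (@idfun V).
Proof.
case: k => [|k] /=; first by move=> x _; exact: cvg_id.
split=> [x _|v]; first exact: (@ex_diff _ _ _ _ _ _ _ (is_diff_id x)).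
rewrite (_ : (fun x => _) = cst v); first exact: Ck_on_cst.
by apply/funext => x; rewrite derive_id.
Qed.

(** Directional derivatives commute with a continuous linear map, so the induction applies to L
    composed with the derivative of f. *)
Lemma Ck_on_lin U V W k (A : set U) (L : {linear V -> W}) (f : U -> V) :
  open A -> continuous L -> Ck_on k A f -> Ck_on k A (L \o f).
Proof.
move=> oA cL; elim: k f => [|k IHk] f /=.
  by move=> Cf x /Cf cf; apply: continuous_comp => //; exact: cL.
case=> df Cdf.
have dL y : differentiable L y by exact: linear_differentiable.
split=> [x /df dfx|v]; first exact: differentiable_comp.
apply: Ck_on_ext (IHk _ (Cdf v)) => // x /df dfx /=.
rewrite !deriveE //; last exact: differentiable_comp.
by rewrite (diff_comp dfx (dL _)) /= (diff_lin _ cL).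
Qed.

Lemma Ck_on_pair U V W k (A : set U) (f : U -> V) (g : U -> W) :
  open A -> Ck_on k A f -> Ck_on k A g -> Ck_on k A (fun x => (f x, g x)).
Proof.
move=> oA; elim: k f g => [|k IHk] f g /=.
  by move=> Cf Cg x Ax; apply: cvg_pair; [exact: Cf | exact: Cg].
move=> [df Cdf] [dg Cdg]; split=> [x Ax|v].
  by apply: differentiable_pair; [exact: df | exact: dg].
apply: Ck_on_ext (IHk _ _ (Cdf v) (Cdg v)) => // x Ax.
have [dfx dgx] := (df x Ax, dg x Ax).
by rewrite !deriveE ?diff_pair //; exact: differentiable_pair.
Qed.

Lemma Ck_onD V W k (A : set V) (f g : V -> W) :
  open A -> Ck_on k A f -> Ck_on k A g -> Ck_on k A (f \+ g).
Proof.
move=> oA; elim: k f g => [|k IHk] f g /=.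
  by move=> Cf Cg x Ax; apply: continuousD; [exact: Cf | exact: Cg].
move=> [df Cdf] [dg Cdg]; split=> [x Ax|v].
  by apply: differentiableD; [exact: df | exact: dg].
apply: Ck_on_ext (IHk _ _ (Cdf v) (Cdg v)) => // x Ax.
by rewrite [RHS]deriveD //; apply: diff_derivable; [exact: df | exact: dg].
Qed.

Lemma derive_bilin U V1 V2 W (B : V1 -> V2 -> W) (f : U -> V1) (g : U -> V2)
    x v :
  bilinear_map B -> continuous (fun p : V1 * V2 => B p.1 p.2) ->
  differentiable f x -> differentiable g x ->
  differentiable (fun y => B (f y) (g y)) x /\
  'D_v (fun y => B (f y) (g y)) x = B (f x) ('D_v g x) + B ('D_v f x) (g x).
Proof.
move=> [linl linr] cB df dg.
pose BM := bilinear_isBilinear.Build R _ _ _ _ _ B (linl, linr).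
pose BB : {bilinear V1 -> V2 -> W} := HB.pack B BM.
have dfg : differentiable (fun y => (f y, g y)) x by exact: differentiable_pair.
have dB : differentiable (fun p : V1 * V2 => B p.1 p.2) (f x, g x).
  exact: (@differentiable_bilin _ _ _ _ BB).
have dBfg : differentiable (fun y => B (f y) (g y)) x.
  exact: (differentiable_comp dfg dB).
split=> //; rewrite !deriveE // (diff_comp dfg dB) /=.
by rewrite (@diff_bilin _ _ _ _ BB) // diff_pair.
Qed.

(** The Leibniz rule turns a derivative of B(f, g) into two terms of the same shape, each with one
    factor differentiated and the other weakened from C^(k+1) to C^k; hence the induction over all f
    and g. *)
Lemma Ck_on_bilin U V1 V2 W (B : V1 -> V2 -> W) k (A : set U)
    (f : U -> V1) (g : U -> V2) :
  open A -> bilinear_map B -> continuous (fun p : V1 * V2 => B p.1 p.2) ->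
  Ck_on k A f -> Ck_on k A g -> Ck_on k A (fun x => B (f x) (g x)).
Proof.
move=> oA bB cB; elim: k f g => [|k IHk] f g.
  move=> /= Cf Cg x Ax; apply: (@continuous2_cvg _ _ _ _ _ _ f g) => //.
  - exact: (cB (f x, g x)).
  - exact: Cf.
  - exact: Cg.
move=> Cf Cg; have [[df Cdf] [dg Cdg]] := (Cf, Cg).
split=> [x Ax|v].
  by have [] := derive_bilin 0 bB cB (df x Ax) (dg x Ax).
have CB1 := IHk _ _ (Ck_onW Cf) (Cdg v).
have CB2 := IHk _ _ (Cdf v) (Ck_onW Cg).
apply: Ck_on_ext (Ck_onD oA CB1 CB2) => // x Ax /=.
by have [_ ->] := derive_bilin v bB cB (df x Ax) (dg x Ax).
Qed.

Lemma Ck_onV V k (A : set V) (f : V -> R) :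
  open A -> (forall x, A x -> f x != 0) -> Ck_on k A f ->
  Ck_on k A (fun x => (f x)^-1).
Proof.
move=> oA f0; elim: k => [|k IHk].
  by move=> /= Cf x Ax; apply: cvgV; [exact: f0 | exact: Cf].
(* The derivative of 1/f is - (1/f)^2 times that of f, and 1/f is already C^k by induction. *)
move=> Cf; have CVf := IHk (Ck_onW Cf); have [df Cdf] := Cf.
split=> [x Ax|v]; first by apply: differentiableV; [exact: df | exact: f0].
have cmul : continuous (fun p : R * R => p.1 * p.2).
  by move=> p; exact: mul_continuous.
have bmul : bilinear_map (@GRing.mul R).
  by split=> [y a b c|y a b c]; rewrite ?mulrDl ?mulrDr -?scalerAl -?scalerAr.
have C2 := Ck_on_bilin oA bmul cmul CVf CVf.
have := Ck_on_bilin oA bmul cmul C2 (Cdf v).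
have cN : continuous (-%R : R -> R) by move=> y; exact: opp_continuous.
move=> /(Ck_on_lin oA cN); apply: Ck_on_ext => // x Ax /=.
have [dfx fx0] := (df x Ax, f0 x Ax).
rewrite !deriveE //; last exact: differentiableV.
by rewrite diffV //= -invfM -expr2 scaleNr.
Qed.

End CkCalculus.

(** * Continuity of linear and bilinear maps on matrix spaces *)

Section MatrixMaps.
Variables (R : realType) (W : normedModType R).

Lemma continuous_sumr (T : topologicalType) (I : Type) (r : seq I)
    (f : I -> T -> W) :
  (forall i, continuous (f i)) -> continuous (fun x => \sum_(i <- r) f i x).
Proof.
move=> cf x; apply: cvg_big => [|i _]; first exact: add_continuous.
exact: cf.
Qed.

Lemma mx_linear_continuous m n (L : {linear 'M[R]_(m, n) -> W}) : continuous L.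
Proof.
have -> : L = (fun M => \sum_i \sum_j M i j *: L (delta_mx i j)) :> (_ -> _).
  apply/funext => M; rewrite {1}(matrix_sum_delta M) linear_sum.
  by apply: eq_bigr => i _; rewrite linear_sum;
    apply: eq_bigr => j _; rewrite linearZ.
apply: continuous_sumr => i; apply: continuous_sumr => j M.
have cZ := @continuousZ R W _ (fun N : 'M[R]_(m, n) => N i j)
  (fun=> L (delta_mx i j)) M.
by apply: cZ; [exact: coord_continuous | exact: cst_continuous].
Qed.

Lemma mx_bilinear_continuous m n p q (B : 'M[R]_(m, n) -> 'M[R]_(p, q) -> W) :
  bilinear_map B -> continuous (fun x : _ * _ => B x.1 x.2).
Proof.
move=> [linl linr].
pose LlM v := GRing.isLinear.Build _ _ _ _ _ (linl v).
pose Ll v : {linear 'M[R]_(m, n) -> W} := HB.pack (B^~ v) (LlM v).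
pose LrM u := GRing.isLinear.Build _ _ _ _ _ (linr u).
pose Lr u : {linear 'M[R]_(p, q) -> W} := HB.pack (B u) (LrM u).
(* Only the first argument is expanded in the basis of elementary matrices; the second is left to
   the linear case. *)
have -> : (fun x : _ * _ => B x.1 x.2) =
    (fun x => \sum_i \sum_j x.1 i j *: Lr (delta_mx i j) x.2).
  apply/funext => -[M N] /=; rewrite {1}(matrix_sum_delta M).
  rewrite -[LHS]/(Ll N _) linear_sum.
  by apply: eq_bigr => i _; rewrite linear_sum;
    apply: eq_bigr => j _; rewrite linearZ.
apply: continuous_sumr => i; apply: continuous_sumr => j -[M N].
have cZ := @continuousZ R W _ (fun x : 'M[R]_(m, n) * 'M[R]_(p, q) => x.1 i j)
  (fun x => Lr (delta_mx i j) x.2) (M, N).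
apply: cZ.
  apply: (@continuous_comp _ _ _ fst (fun M : 'M[R]_(m, n) => M _ _)).
    exact: cvg_fst.
  exact: coord_continuous.
apply: (@continuous_comp _ _ _ snd (Lr _)); first exact: cvg_snd.
exact: mx_linear_continuous.
Qed.

End MatrixMaps.

(** * Algebra of paraquaternions and of the maps w |-> Im (p w q) *)

Section ParaquaternionAlgebra.
Variable R : realType.
Implicit Types (p q r s : pquat R) (w : 'cV[R]_3).

Lemma pqRe_is_linear : linear (@pqRe R : pquat R -> R).
Proof. by move=> a p q; rewrite /pqRe !mxE. Qed.
HB.instance Definition _ :=
  GRing.isLinear.Build R (pquat R) R _ (@pqRe R) pqRe_is_linear.

Lemma pqIm0 p : pqIm p 0 0 = p 1 0.
Proof. by rewrite mxE; congr (p _ _); apply: val_inj. Qed.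

Lemma pqIm1 p : pqIm p 1 0 = p 2 0.
Proof. by rewrite mxE; congr (p _ _); apply: val_inj. Qed.

Lemma pqIm2 p : pqIm p 2 0 = p 3 0.
Proof. by rewrite mxE; congr (p _ _); apply: val_inj. Qed.

Definition pqImE := (pqIm0, pqIm1, pqIm2).

Lemma pureE w : pure w = pq4 0 (w 0 0) (w 1 0) (w 2 0).
Proof.
apply: pq_ReIm; first by rewrite pqRe_pure /pqRe pq4E.
rewrite pureK; apply/colP => -[[|[|[|//]]] i3]; rewrite !mxE /=;
  by congr (w _ _); apply: val_inj.
Qed.

Lemma pure_is_linear : linear (@pure R).
Proof.
move=> a w w'; rewrite !pureE.
by apply: pq_ext; rewrite !(pq4E, mxE) /= ?mulr0 ?addr0.
Qed.
HB.instance Definition _ :=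
  GRing.isLinear.Build R 'cV[R]_3 (pquat R) _ (@pure R) pure_is_linear.

Lemma pqconjM p q : pqconj (p * q) = pqconj q * pqconj p.
Proof. by apply: pq_ext; rewrite !pq4E; ring. Qed.

Lemma pqconjK : involutive (@pqconj R).
Proof. by move=> p; apply: pq_ext; rewrite !pq4E ?opprK. Qed.

Lemma pqconj1 : pqconj (1 : pquat R) = 1.
Proof. by apply: pq_ext; rewrite !pq4E ?oppr0. Qed.

Lemma pqnorm2_conj p : pqnorm2 (pqconj p) = pqnorm2 p.
Proof. by rewrite /pqnorm2 !pq4E !sqrrN. Qed.

Lemma pqnorm2Z (a : R) p : pqnorm2 (a *: p) = a ^+ 2 * pqnorm2 p.
Proof. by rewrite /pqnorm2 !mxE; ring. Qed.

Lemma pqnorm2_Re p : pqnorm2 p = pqRe (p * pqconj p).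
Proof. by rewrite mul_pqconj /pqRe !mxE /= mulr1. Qed.

Lemma pqnorm2_sub1 p : pqnorm2 (p + 1) - pqnorm2 (p - 1) = 4 * pqRe p.
Proof. by rewrite /pqnorm2 /pqRe !mxE /=; ring. Qed.

Lemma pq_unitE p : (p \is a GRing.unit) = (pqnorm2 p != 0).
Proof. by []. Qed.

Lemma pqVE p : pqnorm2 p != 0 -> p^-1 = (pqnorm2 p)^-1 *: pqconj p.
Proof. by move=> /negPf p0; rewrite /GRing.inv /= /pq_inv p0. Qed.

Lemma pqnorm2V p : pqnorm2 p != 0 -> pqnorm2 p^-1 = (pqnorm2 p)^-1.
Proof.
by move=> p0; rewrite pqVE // pqnorm2Z pqnorm2_conj expr2 -mulrA mulVf ?mulr1.
Qed.

Lemma pure_pqIm p : pure (pqIm p) = 2^-1 *: (p - pqconj p).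
Proof. by apply: pq_ext; rewrite pureE !(pq4E, pqImE, mxE) /=; field. Qed.

(** This makes w |-> conj p w p an endomorphism of Im pH, so that no real part is lost when it is
    read as a 3 x 3 matrix. *)
Lemma pqRe_conj_pure p w : pqRe (pqconj p * pure w * p) = 0.
Proof. by rewrite pureE /pqRe !pq4E; ring. Qed.

(** The matrix of w |-> Im (p w q) in the basis r1, r2, r3. Keeping p and q independent makes it
    bilinear, which yields its smoothness from [Ck_on_bilin]. *)
Definition sandwich p q : 'M[R]_3 :=
  \matrix_(i, j) pqIm (p * pure (delta_mx j 0) * q) i 0.

Lemma mul_sandwich p q w : sandwich p q *m w = pqIm (p * pure w * q).
Proof.
rewrite {2}(matrix_sum_delta w).
under eq_bigr do rewrite big_ord1.
rewrite linear_sum mulr_sumr mulr_suml linear_sum /=.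
apply/colP => i; rewrite mxE summxE; apply: eq_bigr => j _.
by rewrite linearZ /= -scalerAr -scalerAl linearZ !mxE mulrC.
Qed.

Lemma det_mx33 (M : 'M[R]_3) :
  \det M = M 0 0 * (M 1 1 * M 2 2 - M 1 2 * M 2 1)
         - M 0 1 * (M 1 0 * M 2 2 - M 1 2 * M 2 0)
         + M 0 2 * (M 1 0 * M 2 1 - M 1 1 * M 2 0).
Proof.
(* Indexing the entries by natural numbers makes equal ordinals, written differently by the cofactor
   expansions, syntactically equal for [ring]. *)
pose m (a b : nat) := M (inord a) (inord b).
have mE i j : M i j = m i j by rewrite /m !inord_val.
rewrite (expand_det_row _ 0) !big_ord_recl big_ord0 /cofactor.
rewrite !(expand_det_row _ 0) !big_ord_recl !big_ord0 /cofactor !det_mx11 !mxE.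
rewrite !mE /= /bump /=.
rewrite -![(1 %% 3)%N]/1%N -![(2 %% 3)%N]/2%N.
ring.
Qed.

(** The columns are conj p r_i p for i = 1, 2, 3. Once they are in closed form, the claim is a
    polynomial identity in the four coordinates of p. *)
Lemma det_sandwich p : \det (sandwich (pqconj p) p) = pqnorm2 p ^+ 3.
Proof.
have d0 : pure (delta_mx 0 0) = r1 R by rewrite pureE !mxE.
have d1 : pure (delta_mx 1 0) = r2 R by rewrite pureE !mxE.
have d2 : pure (delta_mx 2 0) = r3 R by rewrite pureE !mxE.
set a := p 0 0; set b := p 1 0; set c := p 2 0; set d := p 3 0.
have c0 : pqconj p * r1 R * p = pq4 0 (a ^+ 2 - b ^+ 2 + c ^+ 2 - d ^+ 2)
    (2 * (a * d - b * c)) (2 * (a * c - b * d)).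
  by apply: pq_ext; rewrite !pq4E -?/a -?/b -?/c -?/d; ring.
have c1 : pqconj p * r2 R * p = pq4 0 (- 2 * (a * d + b * c))
    (a ^+ 2 + b ^+ 2 - c ^+ 2 - d ^+ 2) (- 2 * (a * b + c * d)).
  by apply: pq_ext; rewrite !pq4E -?/a -?/b -?/c -?/d; ring.
have c2 : pqconj p * r3 R * p = pq4 0 (2 * (a * c + b * d))
    (2 * (c * d - a * b)) (a ^+ 2 + b ^+ 2 + c ^+ 2 + d ^+ 2).
  by apply: pq_ext; rewrite !pq4E -?/a -?/b -?/c -?/d; ring.
have s0 i : sandwich (pqconj p) p i 0 = pqIm (pqconj p * r1 R * p) i 0.
  by rewrite mxE d0.
have s1 i : sandwich (pqconj p) p i 1 = pqIm (pqconj p * r2 R * p) i 0.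
  by rewrite mxE d1.
have s2 i : sandwich (pqconj p) p i 2 = pqIm (pqconj p * r3 R * p) i 0.
  by rewrite mxE d2.
rewrite det_mx33 !s0 !s1 !s2 c0 c1 c2.
rewrite !pqImE !pq4E.
by rewrite /pqnorm2 -/a -/b -/c -/d; ring.
Qed.

End ParaquaternionAlgebra.

(** * The conformal relation of the two contact forms, as an algebraic identity *)

Section CayleyAlgebra.
Variables (R : realType) (n : nat).
Implicit Types (s p d : pquat R) (q dq : hvec R n).

(** For |s|^2 <> 0 this is the matrix of w |-> s^-1 w s, as s^-1 = |s|^-2 conj s. *)
Definition conj_rot s : 'M[R]_3 := (pqnorm2 s)^-1 *: sandwich (pqconj s) s.

Lemma pure_conj_rot s w :
  pure (conj_rot s *m w) = (pqnorm2 s)^-1 *: (pqconj s * pure w * s).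
Proof.
by rewrite -scalemxAl linearZ /= mul_sandwich pqImK ?pqRe_conj_pure.
Qed.

(** In dimension 3 the scalar contributes |s|^-6 to the determinant, which cancels the |s|^6 of
    [det_sandwich]. Invariance of the quadratic form is multiplicativity of the norm. *)
Lemma conj_rot_SO12 s : pqnorm2 s != 0 -> SO12 (conj_rot s).
Proof.
move=> s0; split=> [|w].
  by rewrite detZ det_sandwich -exprMn mulVf ?expr1n.
rewrite pure_conj_rot pqnorm2Z !pqnorm2M pqnorm2_conj.
by field.
Qed.

Lemma hcoordE (u : pquat R) q a : hcoord (hmul u q) a = u * hcoord q a.
Proof. by apply/colP => i; rewrite !mxE. Qed.

Lemma hdot_hmul (u v : pquat R) q q' :
  hdot (hmul u q) (hmul v q') = u * hdot q q' * pqconj v.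
Proof.
rewrite /hdot mulr_sumr mulr_suml; apply: eq_bigr => a _.
by rewrite !hcoordE pqconjM !mulrA.
Qed.

Lemma hnorm2_hmul u q : hnorm2 (hmul u q) = pqnorm2 u * hnorm2 q.
Proof.
by rewrite /hnorm2 mulr_sumr; apply: eq_bigr => a _; rewrite hcoordE pqnorm2M.
Qed.

(* 2 C^* Theta is the left-hand side minus its conjugate. *)
Lemma cayley_half_form q p dq d (u := (p - 1)^-1) :
  pqnorm2 (p - 1) != 0 -> hnorm2 q + pqnorm2 p = 1 ->
  - (u * d * u) + hdot (hmul u dq - hmul (u * d * u) q) (hmul u q) =
  u * (hdot dq q + d * pqconj p) * pqconj u.
Proof.
move=> s0 Sqp; set s := p - 1 in s0 u *; set N := pqnorm2 s in s0.
have uE : u = N^-1 *: pqconj s by rewrite /u pqVE.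
have cuE : pqconj u = N^-1 *: s by rewrite uE linearZ /= pqconjK.
rewrite hdotDl hdotNl !hdot_hmul hdotxx.
have qE : hnorm2 q = 1 - pqnorm2 p by rewrite -Sqp addrK.
(* The sphere equation enters here: multiplied by |s|^2, with s = p - 1, this reads conj s + 1 -
   conj p p = - conj p s. It collects the two terms that contain u d u. *)
have key : u + u * (hnorm2 q)%:A * pqconj u = - (pqconj p * pqconj u).
  rewrite -scalerAr mulr1 -scalerAl mul_pqconj pqnorm2V // -/N cuE uE.
  rewrite -scalerAr scalerA mulrC -scalerA -scalerDr -scalerN.
  congr (_ *: _).
  rewrite qE scalerBl scale1r -pqconj_mul /s linearB /= pqconj1 mulrBr mulr1.
  by rewrite opprB addrA subrK.
rewrite mulrDr mulrDl addrCA -!mulrA; congr (_ + _).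
rewrite -mulrA in key.
by rewrite -opprD -!mulrDr key !mulrN opprK.
Qed.

(** With Z = dq conj q + d conj p, one has eta = Z - conj Z, and twice the left-hand side is u eta
    conj u. Since u = |s|^-2 conj s for s = p - 1, this equals |s|^-4 conj s eta s, that is |s|^-2
    times the rotated eta. *)
Lemma cayley_form q p dq d (u := (p - 1)^-1) :
  pqnorm2 (p - 1) != 0 -> hnorm2 q + pqnorm2 p = 1 ->
  heis_form R n (hmul u q, pqIm (u * (p + 1)))
    (hmul u dq - hmul (u * d * u) q, pqIm (- (2 *: (u * d * u)))) =
  (2 * pqnorm2 (p - 1))^-1 *:
    (conj_rot (p - 1) *m sphere_form R n (q, p) (dq, d)).
Proof.
move=> s0 Sqp; apply: (can_inj (@pureK R)).
have half := cayley_half_form dq d s0 Sqp; rewrite -/u in half.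
set q' := hmul u q in half *; set dq' := hmul u dq - _ in half *.
set X := u * d * u in half *; set Z := hdot dq q + _ in half.
have cuE : pqconj u = (pqnorm2 (p - 1))^-1 *: (p - 1).
  by rewrite /u pqVE // linearZ /= pqconjK.
have ZE : pure (sphere_form R n (q, p) (dq, d)) = Z - pqconj Z.
  rewrite sphere_form_im /= /Z linearD /= -hdotC pqconjM pqconjK.
  by rewrite opprD addrA.
rewrite heis_form_im [RHS]linearZ /= pure_conj_rot ZE.
rewrite (hdotC dq' q') pure_pqIm.
(* The factor 2 of dp' = - 2 X cancels the 1/2 of the imaginary part. *)
have -> : 2^-1 *: (- (2 *: X) - pqconj (- (2 *: X))) = - X + pqconj X.
  have -> : pqconj (- (2 *: X)) = - (2 *: pqconj X).
    by rewrite raddfN /= linearZ.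
  by rewrite opprK -scalerN -scalerDr scalerA mulVf ?pnatr_eq0 // scale1r.
have -> : - X + pqconj X - pqconj (hdot dq' q') + hdot dq' q' =
    u * Z * pqconj u - pqconj (u * Z * pqconj u).
  rewrite -half linearD raddfN /= opprD opprK.
  by rewrite -[_ + _ - _ in LHS]addrA addrAC.
rewrite !pqconjM pqconjK mulrA -mulrBl -mulrBr cuE [X in X * _ * _]pqVE //.
by rewrite -scalerAr -!scalerAl !scalerA; congr (_ *: _); field.
Qed.

End CayleyAlgebra.

(** * Smoothness of the paraquaternionic operations *)

Section ParaquaternionCalculus.
Variables (R : realType) (n : nat) (V : normedModType R).
Implicit Types (A : set V) (f g : V -> pquat R) (h : V -> hvec R n).

Lemma pqmul_bilinear : bilinear_map (@GRing.mul (pquat R)).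
Proof.
by split=> [q a p p' | p a q q']; rewrite ?mulrDl ?mulrDr -?scalerAl -?scalerAr.
Qed.

Lemma pqmul_continuous : continuous (fun x : pquat R * pquat R => x.1 * x.2).
Proof. exact: mx_bilinear_continuous pqmul_bilinear. Qed.

Lemma hcoord_inj (q q' : hvec R n) :
  (forall a, hcoord q a = hcoord q' a) -> q = q'.
Proof.
move=> eqq'; apply/matrixP => i a.
by have /colP/(_ i) := eqq' a; rewrite !mxE.
Qed.

Lemma hcoordZ (c : R) (q : hvec R n) a : hcoord (c *: q) a = c *: hcoord q a.
Proof. by apply/colP => i; rewrite !mxE. Qed.

Lemma hmul_bilinear : bilinear_map (@hmul R n).
Proof.
split=> [q a u v | u a q q']; apply: hcoord_inj => i /=.
  by rewrite hcoordD hcoordZ !hcoordE mulrDl -scalerAl.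
by rewrite !(hcoordD, hcoordZ, hcoordE) mulrDr -scalerAr.
Qed.

Lemma hmul_continuous : continuous (fun x : pquat R * hvec R n => hmul x.1 x.2).
Proof. exact: mx_bilinear_continuous hmul_bilinear. Qed.

Lemma scale_bilinear (W : normedModType R) : bilinear_map (@GRing.scale R W).
Proof.
split=> [w a b c | b a w w'] /=; rewrite ?scalerDl ?scalerDr !scalerA //.
by rewrite mulrC.
Qed.

Lemma sandwich_bilinear : bilinear_map (@sandwich R).
Proof.
split=> [q a p p' | p a q q']; apply/matrixP => i j; rewrite /= mxE [RHS]mxE.
  rewrite [(a *: sandwich p q) i j]mxE ![sandwich _ _ i j]mxE.
  by rewrite !mulrDl -!scalerAl linearP [LHS]mxE [(a *: pqIm _) i 0]mxE.
rewrite [(a *: sandwich p q) i j]mxE ![sandwich _ _ i j]mxE.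
by rewrite !mulrDr -!scalerAr linearP [LHS]mxE [(a *: pqIm _) i 0]mxE.
Qed.

Lemma sandwich_continuous :
  continuous (fun x : pquat R * pquat R => sandwich x.1 x.2).
Proof. exact: mx_bilinear_continuous sandwich_bilinear. Qed.

Lemma Ck_onZ (W : normedModType R) k A (a : V -> R) (f : V -> W) :
  open A -> Ck_on k A a -> Ck_on k A f -> Ck_on k A (fun x => a x *: f x).
Proof.
move=> oA; apply: Ck_on_bilin oA (@scale_bilinear W) _.
by move=> x; exact: scale_continuous.
Qed.

Lemma Ck_on_conj k A f :
  open A -> Ck_on k A f -> Ck_on k A (fun x => pqconj (f x)).
Proof. by move=> oA; apply: Ck_on_lin => //; exact: mx_linear_continuous. Qed.

Lemma Ck_on_pqnorm2 k A f :
  open A -> Ck_on k A f -> Ck_on k A (fun x => pqnorm2 (f x)).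
Proof.
move=> oA Cf; have -> : (fun x => pqnorm2 (f x)) =
    (@pqRe R) \o (fun x => f x * pqconj (f x)).
  by apply/funext => x /=; rewrite pqnorm2_Re.
apply: Ck_on_lin => //; first exact: mx_linear_continuous.
apply: (Ck_on_bilin oA pqmul_bilinear pqmul_continuous Cf).
exact: Ck_on_conj.
Qed.

Lemma Ck_on_pqV k A f : open A -> (forall x, A x -> pqnorm2 (f x) != 0) ->
  Ck_on k A f -> Ck_on k A (fun x => (f x)^-1).
Proof.
move=> oA f0 Cf.
apply: (@Ck_on_ext _ _ _ _ _
  (fun x => (pqnorm2 (f x))^-1 *: pqconj (f x))) => //.
  by move=> x Ax; rewrite pqVE // f0.
apply: Ck_onZ => //; last exact: Ck_on_conj.
by apply: Ck_onV => //; exact: Ck_on_pqnorm2.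
Qed.

Lemma open_pqnorm2_neq0 f : (forall k, Ck_on k setT f) ->
  open [set x | pqnorm2 (f x) != 0].
Proof.
move=> Cf; have cN x : {for x, continuous (fun x => pqnorm2 (f x))}.
  by apply: (Ck_on_pqnorm2 openT (Cf 0)).
apply: (@open_comp _ _ (fun x => pqnorm2 (f x)) [set r | r != 0]) => [x _|].
  exact: cN.
exact: open_neq.
Qed.

(** Obtained by differentiating f f^-1 = 1, which holds near x, and multiplying by f^-1 on the
    left. *)
Lemma derive_pqV f x v : differentiable f x ->
  (\near x, pqnorm2 (f x) != 0) -> differentiable (fun y => (f y)^-1) x ->
  'D_v (fun y => (f y)^-1) x = - ((f x)^-1 * 'D_v f x * (f x)^-1).
Proof.
move=> df nf0 dVf; have f0 := nbhs_singleton nf0.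
have [_ ] := derive_bilin v pqmul_bilinear pqmul_continuous df dVf.
rewrite (@near_eq_derive R V (pquat R) _ (cst (1 : pquat R))); last first.
  by apply: filterS nf0 => y f0y; rewrite mulrV // pq_unitE.
rewrite derive_cst => /esym/eqP; rewrite addr_eq0 => /eqP fD.
by rewrite -[LHS](mulKr (f0 : f x \is a GRing.unit)) fD mulrN mulrA.
Qed.

End ParaquaternionCalculus.

(** * Smoothness of the Cayley transform and of its candidate inverse *)

Section Cayley.
Variables (R : realType) (n : nat).
Implicit Types (x y v : ambient R n).

(** This open set of the ambient space serves on both sides: the Cayley transform maps it
    bijectively to itself. *)
Definition cayley_domain : set (ambient R n) :=
  [set x | pqnorm2 (x.2 - 1) != 0].

Definition cayley_inv y : ambient R n :=
  (hmul (2 *: (y.2 - 1)^-1) y.1, 1 + 2 *: (y.2 - 1)^-1).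

Lemma Ck_on_fst k (A : set (ambient R n)) : open A -> Ck_on k A fst.
Proof.
move=> oA; apply: (Ck_on_lin oA (L := fst)); last exact: Ck_on_id.
by move=> x; exact: cvg_fst.
Qed.

Lemma Ck_on_snd k (A : set (ambient R n)) : open A -> Ck_on k A snd.
Proof.
move=> oA; apply: (Ck_on_lin oA (L := snd)); last exact: Ck_on_id.
by move=> x; exact: cvg_snd.
Qed.

Lemma Ck_on_snd_add k (A : set (ambient R n)) (c : pquat R) :
  open A -> Ck_on k A (fun x => x.2 + c).
Proof. by move=> oA; apply: Ck_onD (Ck_on_snd _ oA) (Ck_on_cst _ _ _). Qed.

Lemma open_cayley_domain : open cayley_domain.
Proof.
apply: (@open_pqnorm2_neq0 _ _ (fun x => x.2 - 1)) => k.
by apply: Ck_on_snd_add; exact: openT.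
Qed.

Lemma Ck_on_cayley_denom k :
  Ck_on k cayley_domain (fun x => (x.2 - 1)^-1).
Proof.
apply: (Ck_on_pqV open_cayley_domain) => //.
exact/Ck_on_snd_add/open_cayley_domain.
Qed.

Lemma smooth_cayley : smooth_on_open cayley_domain (cayley R n).
Proof.
have oA := open_cayley_domain => k; have Cu := Ck_on_cayley_denom k.
apply: (Ck_on_pair oA).
  exact: (Ck_on_bilin oA (@hmul_bilinear R n) (@hmul_continuous R n) Cu
    (Ck_on_fst _ oA)).
apply: (Ck_on_bilin oA (@pqmul_bilinear R) (@pqmul_continuous R) Cu).
exact: Ck_on_snd_add.
Qed.

Lemma smooth_cayley_inv : smooth_on_open cayley_domain cayley_inv.
Proof.
have oA := open_cayley_domain => k; have Cu := Ck_on_cayley_denom k.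
have C2u : Ck_on k cayley_domain (fun y => 2 *: (y.2 - 1)^-1).
  exact: (Ck_onZ oA (Ck_on_cst (V := ambient R n) k cayley_domain (2 : R)) Cu).
apply: (Ck_on_pair oA).
  exact: (Ck_on_bilin oA (@hmul_bilinear R n) (@hmul_continuous R n) C2u
    (Ck_on_fst _ oA)).
exact: (Ck_onD oA
  (Ck_on_cst (V := ambient R n) k cayley_domain (1 : pquat R)) C2u).
Qed.

(** * The rational inverse of the Cayley transform *)

Lemma hmulA (u v : pquat R) (q : hvec R n) : hmul u (hmul v q) = hmul (u * v) q.
Proof. by apply: hcoord_inj => a; rewrite !hcoordE mulrA. Qed.

Lemma hmul1 (q : hvec R n) : hmul 1 q = q.
Proof. by apply: hcoord_inj => a; rewrite hcoordE mul1r. Qed.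

Lemma cayley2_sub1 x : cayley_domain x ->
  (cayley R n x).2 - 1 = 2 *: (x.2 - 1)^-1.
Proof.
(* Writing 1 as u (p - 1) leaves u ((p + 1) - (p - 1)) = 2 u. *)
move=> Ax; rewrite -[X in _ * _ - X](mulVr (Ax : x.2 - 1 \is a GRing.unit)).
rewrite -mulrBr (_ : x.2 + 1 - (x.2 - 1) = 2%:R) ?mulr_natr ?scaler_nat //.
by rewrite opprB [LHS]addrC subrKA.
Qed.

Lemma cayley_inv2_sub1 y : (cayley_inv y).2 - 1 = 2 *: (y.2 - 1)^-1.
Proof. by rewrite addrC addKr. Qed.

(** Both round trips rest on this: in the variable p - 1 the transform and its inverse act by the
    same involution u |-> 2 u^-1. *)
Lemma pq_inv2Z (u : pquat R) : pqnorm2 u != 0 -> 2 *: (2 *: u^-1)^-1 = u.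
Proof.
move=> u0; rewrite invrZ ?unitfE ?pnatr_eq0 // ?unitrV //.
by rewrite scalerA mulfV ?pnatr_eq0 // scale1r invrK.
Qed.

Lemma cayley_domainP x : cayley_domain x -> cayley_domain (cayley R n x).
Proof.
move=> Ax; rewrite /cayley_domain /= cayley2_sub1 // pqnorm2Z pqnorm2V //.
by rewrite mulf_neq0 ?expf_neq0 ?pnatr_eq0 ?invr_eq0.
Qed.

Lemma cayley_inv_domainP y : cayley_domain y -> cayley_domain (cayley_inv y).
Proof.
move=> Ay; rewrite /cayley_domain /= cayley_inv2_sub1 // pqnorm2Z pqnorm2V //.
by rewrite mulf_neq0 ?expf_neq0 ?pnatr_eq0 ?invr_eq0.
Qed.

Lemma cayleyK x : cayley_domain x -> cayley_inv (cayley R n x) = x.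
Proof.
move=> Ax; rewrite /cayley_inv cayley2_sub1 // pq_inv2Z // hmulA mulrV ?hmul1.
  by rewrite addrC subrK -surjective_pairing.
exact: Ax.
Qed.

Lemma cayley_invK y : cayley_domain y -> cayley R n (cayley_inv y) = y.
Proof.
move=> Ay; have Uy : y.2 - 1 \is a GRing.unit by exact: Ay.
have U2 : 2 *: (y.2 - 1)^-1 \is a GRing.unit.
  by have := cayley_inv_domainP Ay; rewrite /cayley_domain /= cayley_inv2_sub1.
rewrite [LHS]surjective_pairing [RHS]surjective_pairing; congr pair.
  by rewrite /= [X in X^-1]addrC addKr hmulA mulVr // hmul1.
apply: (addIr (-1)); rewrite cayley2_sub1; last exact: cayley_inv_domainP.
by rewrite cayley_inv2_sub1 pq_inv2Z.
Qed.

(** * The image of the pseudo-sphere and the differential of the transform *)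

Lemma sphere_sub_sigma0E x :
  (pseudo_sphere R n `\` sigma0 R n) x <->
  pseudo_sphere R n x /\ cayley_domain x.
Proof.
split=> -[Sx Ax]; split=> //.
  by apply/eqP => x0; apply: Ax.
by case=> _ x0; move: Ax; rewrite /cayley_domain /= x0 eqxx.
Qed.

Lemma cayley_hypersurface x : cayley_domain x ->
  heis_hypersurface R n (cayley R n x) <-> pseudo_sphere R n x.
Proof.
move=> Ax; set N := pqnorm2 (x.2 - 1) in Ax *.
have p1E : (cayley R n x).2 + 1 = 2 *: ((x.2 - 1)^-1 * x.2).
  have -> : (cayley R n x).2 + 1 = (cayley R n x).2 - 1 + 2%:R.
    by rewrite -addrA; congr (_ + _); rewrite addrC addrK.
  rewrite cayley2_sub1 // -[X in _ = 2 *: (_ * X)](subrK 1).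
  rewrite mulrDr mulVr ?mulr1 //.
  by rewrite scalerDr [RHS]addrC (scaler_nat 2 (1 : pquat R)).
(* From 4 Re p' = |p' + 1|^2 - |p' - 1|^2, with p' + 1 = 2 u p and p' - 1 = 2 u. *)
have ReE : pqRe (cayley R n x).2 = N^-1 * (pqnorm2 x.2 - 1).
  apply: (@mulfI _ 4); first by rewrite pnatr_eq0.
  rewrite -pqnorm2_sub1 p1E cayley2_sub1 // !pqnorm2Z pqnorm2M pqnorm2V // -/N.
  by ring.
rewrite /heis_hypersurface /pseudo_sphere /= ReE hnorm2_hmul pqnorm2V // -/N.
rewrite -mulrN; split=> [/(mulfI (invr_neq0 Ax)) pE|<-].
  by rewrite -(subrK 1 (pqnorm2 x.2)) pE addrA subrr add0r.
by rewrite opprD addrCA subrr addr0.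
Qed.

(** The Leibniz rule is applied to both products, with du = - u dp u. After projection by
    [heis_of_sigma], the result is the vector at which [cayley_form] evaluates [heis_form]. *)
Lemma diff_cayley x v (u := (x.2 - 1)^-1) : cayley_domain x ->
  'd (cayley R n) x v =
  (hmul u v.1 - hmul (u * v.2 * u) x.1, - (2 *: (u * v.2 * u))).
Proof.
move=> Ax; have oA := open_cayley_domain.
have nA : \forall y \near x, cayley_domain y.
  exact: (open_nbhs_nbhs (conj oA Ax)).
have [du _] := Ck_on_cayley_denom 1; have {}du := du x Ax.
have [dq _] := Ck_on_fst 1 oA; have {}dq := dq x Ax.
have [dp _] := Ck_on_snd 1 oA; have {}dp := dp x Ax.
have [dm _] := Ck_on_snd_add 1 (-1) oA; have {}dm := dm x Ax.
have [dn _] := Ck_on_snd_add 1 1 oA; have {}dn := dn x Ax.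
have Dq : 'D_v (fst : ambient R n -> hvec R n) x = v.1.
  rewrite deriveE // diff_lin //; by move=> z; exact: cvg_fst.
have Dp c : 'D_v (fun y : ambient R n => y.2 + c) x = v.2.
  rewrite [LHS](deriveD (diff_derivable dp) (derivable_cst _ _ _)).
  rewrite derive_cst addr0.
  rewrite deriveE // diff_lin //; by move=> z; exact: cvg_snd.
have Du : 'D_v (fun y : ambient R n => (y.2 - 1)^-1) x = - (u * v.2 * u).
  by rewrite derive_pqV // Dp.
have [d1 D1] :=
  derive_bilin v (@hmul_bilinear R n) (@hmul_continuous R n) du dq.
have [d2 D2] := derive_bilin v (@pqmul_bilinear R) (@pqmul_continuous R) du dn.
rewrite (diff_pair d1 d2) -!deriveE // D1 D2 Dq Dp Du.
congr pair.
  apply: hcoord_inj => a.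
  by rewrite !(hcoordD, hcoordN, hcoordE) mulNr.
(* As u (p + 1) = 1 + 2 u, the terms u dp in u dp - u dp u (p + 1) cancel and - 2 u dp u remains. *)
have := cayley2_sub1 Ax; rewrite /= -/u => /eqP; rewrite subr_eq => /eqP c2.
rewrite mulNr -!mulrA c2 addrC !mulrDr mulr1 opprD.
by rewrite subrK -!scalerAr.
Qed.

Lemma diff_heis_of_sigma y v : 'd (@heis_of_sigma R n) y v = heis_of_sigma v.
Proof.
have linH : linear (@heis_of_sigma R n).
  by move=> a x z; rewrite /heis_of_sigma /= linearP.
pose HM := GRing.isLinear.Build R (ambient R n) (heis R n) _ _ linH.
pose H : {linear ambient R n -> heis R n} := HB.pack (@heis_of_sigma R n) HM.
have cH : continuous H.
  move=> x; have c1 : z.1 @[z --> x] --> x.1 by exact: cvg_fst.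
  have c2 : pqIm z.2 @[z --> x] --> pqIm x.2.
    apply: (@continuous_comp _ _ _ snd (@pqIm R)); first exact: cvg_snd.
    exact: mx_linear_continuous.
  exact: cvg_pair c1 c2.
by rewrite (@diff_lin R _ _ H y cH).
Qed.

Lemma smooth_onS (V W : normedModType R) (S A : set V) (f : V -> W) :
  open A -> S `<=` A -> smooth_on_open A f -> smooth_on S f.
Proof. by move=> oA SA sf x Sx; exists A, f; split=> //; exact: SA. Qed.

End Cayley.

(** * Local invertibility and conformality of the Cayley transform *)

Theorem proposition3p1 (R : realType) (n : nat) :
  local_diffeo (pseudo_sphere R n `\` sigma0 R n) (heis_hypersurface R n)
    (cayley R n) /\
  pqc_conformal (pseudo_sphere R n `\` sigma0 R n)
    (sphere_form R n) (pullback (cayley R n) (sigma_form R n)).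
Proof.
have oA := @open_cayley_domain R n.
split.
  move=> x0 /sphere_sub_sigma0E [S0 A0].
  exists (@cayley_domain R n), (@cayley_domain R n), (@cayley_inv R n).
  split=> //.
  - apply/seteqP; split=> [_ [x [/sphere_sub_sigma0E [Sx Ax] _] <-] |].
      by split; [exact/(cayley_hypersurface Ax) | exact: cayley_domainP].
    move=> y [Hy Ay]; exists (cayley_inv y); last by rewrite cayley_invK.
    have Ay' := cayley_inv_domainP Ay.
    split=> //; apply/sphere_sub_sigma0E; split=> //.
    by apply/(cayley_hypersurface Ay'); rewrite cayley_invK.
  - by move=> x /set_mem [_ Ax]; exact: cayleyK.
  - split; apply: smooth_onS (oA) _ _; try by move=> x [].
      exact: smooth_cayley.
    exact: smooth_cayley_inv.
(* Both witnesses are smooth on the whole open domain, so each is its own ambient extension near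
   every point of the punctured sphere. *)
exists (fun x => (2 * pqnorm2 (x.2 - 1))^-1), (fun x => conj_rot (x.2 - 1)).
have SA : pseudo_sphere R n `\` sigma0 R n `<=` @cayley_domain R n.
  by move=> x /sphere_sub_sigma0E[].
have CN k : Ck_on k (@cayley_domain R n) (fun x => pqnorm2 (x.2 - 1)).
  by apply: Ck_on_pqnorm2 => //; exact: Ck_on_snd_add.
split.
- apply: smooth_onS (oA) SA _ => k.
  apply: (Ck_onV oA) => [x Ax|]; first by rewrite mulf_neq0 ?pnatr_eq0.
  exact: (Ck_onZ oA
    (Ck_on_cst (V := ambient R n) k (@cayley_domain R n) (2 : R)) (CN k)).
- apply: smooth_onS (oA) SA _ => k.
  apply: (Ck_onZ oA); first exact: (Ck_onV oA).
  have Cs := @Ck_on_snd_add R n k _ (-1) oA.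
  exact: (Ck_on_bilin oA (@sandwich_bilinear R) (@sandwich_continuous R)
    (Ck_on_conj oA Cs) Cs).
- by move=> x /SA Ax; rewrite invr_neq0 // mulf_neq0 ?pnatr_eq0.
- by move=> x /SA Ax; exact: conj_rot_SO12.
- move=> x v /sphere_sub_sigma0E [Sx Ax] _.
  (* The two differentials turn the pulled-back form into the left-hand side of [cayley_form]. *)
  rewrite /pullback /sigma_form /pullback diff_cayley // diff_heis_of_sigma.
  by rewrite [LHS](cayley_form _ _ Ax Sx) -!surjective_pairing.
Qed.
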